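(* Let $\mathbf{p}$ be a planar rational parametric curve of degree $n$ in homogeneous form on $[0,1]$, and let $(q_k)_{k=1}^M$ be a basis for the implicit polynomials of degree $m$. For each integer $L\ge \max(2,mn+1)$, let $\mathbf{D}_{\mathrm{B},L}\in\mathbb{R}^{L\times M}$ be the matrix whose $k$-th column consists of the coefficients of $q_k\circ\mathbf{p}$ in the Bernstein polynomial basis of degree $L-1$, i.e. $$q_k(\mathbf{p}(t))=\sum_{j=1}^L(\mathbf{D}_{\mathrm{B},L})_{j,k}\binom{L-1}{j-1}t^{j-1}(1-t)^{L-j},\qquad k=1,\dots,M,$$ and let $\mathbf{D}_{\mathrm{L},L}\in\mathbb{R}^{L\times M}$ be the corresponding matrix in the Lagrange basis of degree $L-1$ at the uniform nodes $t_j=(j-1)/(L-1)$, i.e. $(\mathbf{D}_{\mathrm{L},L})_{j,k}=q_k(\mathbf{p}(t_j))$. Then, as the degree is raised, the elements of $\mathbf{D}_{\mathrm{B},L}$ converge to the elements of $\mathbf{D}_{\mathrm{L},L}$: for each $k=1,\dots,M$, $$\lim_{L\to\infty}\ \max_{1\le j\le L}\left|(\mathbf{D}_{\mathrm{B},L})_{j,k}-(\mathbf{D}_{\mathrm{L},L})_{j,k}\right|=0 .$$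
   Context: A planar rational parametric curve of degree $n$ is represented in homogeneous form as $\mathbf{p}(t)=(g_1(t),g_2(t),h(t))$, where $g_1,g_2,h$ are real polynomials of degree at most $n$. The implicit basis $(q_k)_{k=1}^M$, $M=\binom{m+2}{2}$, is a fixed basis of the homogeneous polynomials of degree $m$ in three variables (by default the Bernstein basis $\binom{m}{k_1,k_2,k_3}u^{k_1}v^{k_2}w^{k_3}$, $k_1+k_2+k_3=m$). Each $q_k\circ\mathbf{p}$ is a univariate polynomial of degree at most $mn$. *)

(* Defs.v *)
From HB Require Import structures.
From mathcomp Require Import all_boot all_order all_algebra.
From mathcomp Require Import all_classical all_reals all_analysis.
(* The notations of mpoly clash with those of analysis. *)
From mathcomp Require Import -(notations) mpoly.

Set Implicit Arguments.
Unset Strict Implicit.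
Unset Printing Implicit Defensive.

Import Order.TTheory GRing.Theory Num.Theory numFieldNormedType.Exports.
Local Open Scope ring_scope.

(* [size] is the degree plus one, so the degrees are at most [n]; no condition
   is put on the zeros of the weight [curve_h]. *)
Record rational_curve (R : realType) (n : nat) := RationalCurve {
  curve_g1 : {poly R};
  curve_g2 : {poly R};
  curve_h : {poly R};
  size_curve_g1 : (size curve_g1 <= n.+1)%N;
  size_curve_g2 : (size curve_g2 <= n.+1)%N;
  size_curve_h : (size curve_h <= n.+1)%N
}.

Definition curve_coord (R : realType) (n : nat) (p : rational_curve R n)
    (i : 'I_3) : {poly R} :=
  tnth [tuple curve_g1 p; curve_g2 p; curve_h p] i.

Definition comp_curve (R : realType) (n m : nat)
    (q : dhomog 3 R m) (p : rational_curve R n) : {poly R} :=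
  mmap polyC (curve_coord p) (mpoly_of_dhomog q).

Definition bernstein (R : realType) (d j : nat) : {poly R} :=
  'C(d, j)%:R *: ('X^j * (1 - 'X) ^+ (d - j)).

(* Rows are numbered from 0, so row [j] goes with the Bernstein polynomial
   whose power of ['X] is [j] and with the node [j / (L - 1)]. *)
Definition is_bernstein_matrix (R : realType) (n m M L : nat)
    (p : rational_curve R n) (q : M.-tuple (dhomog 3 R m))
    (D : 'M[R]_(L, M)) : Prop :=
  forall k : 'I_M,
    comp_curve (tnth q k) p = \sum_(j < L) D j k *: bernstein R L.-1 j.

Definition uniform_node (R : realType) (L j : nat) : R := j%:R / L.-1%:R.

Definition lagrange_matrix (R : realType) (n m M : nat)
    (p : rational_curve R n) (q : M.-tuple (dhomog 3 R m))
    (L : nat) : 'M[R]_(L, M) :=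
  \matrix_(j < L, k < M) (comp_curve (tnth q k) p).[uniform_node R L j].

Lemma bernstein_span (R : realType) (d : nat) (a : {poly R}) :
  (size a <= d.+1)%N ->
  exists c : 'I_d.+1 -> R, a = \sum_(j < d.+1) c j *: bernstein R d j.
Proof.
move=> sa.
suff H (i : 'I_d.+1) : exists c : 'I_d.+1 -> R,
    'X^i = \sum_(j < d.+1) c j *: bernstein R d j.
  have [c Hc] := choice H.
  exists (fun j => \sum_(i < d.+1) a`_i * c i j).
  have Ea : a = \sum_(i < d.+1) a`_i *: 'X^i.
    rewrite -poly_def; apply/polyP => i; rewrite coef_poly.
    by case: ltnP => // hi; rewrite nth_default // (leq_trans sa).
  rewrite [LHS]Ea.
  rewrite (eq_bigr (fun i : 'I_d.+1 =>
    \sum_(j < d.+1) (a`_i * c i j) *: bernstein R d j)); last first.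
    by move=> i _; rewrite Hc scaler_sumr; apply: eq_bigr => j _; rewrite scalerA.
  by rewrite exchange_big /=; apply: eq_bigr => j _; rewrite -scaler_suml.
have id : (i <= d)%N by rewrite -ltnS.
exists (fun j : 'I_d.+1 =>
  if (i <= j)%N then 'C(d - i, j - i)%:R / 'C(d, j)%:R else 0).
have -> : 'X^i = 'X^i * ((1 - 'X) + 'X) ^+ (d - i) :> {poly R}.
  by rewrite subrK expr1n mulr1.
pose F j : {poly R} :=
  (if (i <= j)%N then 'C(d - i, j - i)%:R / 'C(d, j)%:R else 0) *: bernstein R d j.
rewrite -[RHS](big_mkord xpredT F) (big_cat_nat (n := i)) //=; last exact: ltnW.
rewrite big_nat big1 ?add0r; last first.
  by move=> j /andP[_ ji]; rewrite /F leqNgt ji scale0r.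
have := big_addn 0 d.+1 i xpredT F; rewrite add0n => ->.
rewrite exprDn mulr_sumr big_mkord subSn //.
apply: eq_bigr => k _; rewrite /F leq_addl addnK /bernstein scalerA.
have kd : (k + i <= d)%N by rewrite addnC -leq_subRL// -ltnS.
rewrite divfK ?pnatr_eq0 -?lt0n ?bin_gt0 // scaler_nat mulrnAr.
rewrite -subnDA [(i + k)%N]addnC exprD; congr (_ *+ _).
by rewrite [X in _ * X]mulrC mulrA [X in X * _]mulrC.
Qed.

Lemma size_comp_curve (R : realType) (n m : nat)
    (q : dhomog 3 R m) (p : rational_curve R n) :
  (size (comp_curve q p) <= (m * n).+1)%N.
Proof.
have sp (i : 'I_3) : (size (curve_coord p i) <= n.+1)%N.
  rewrite /curve_coord (tnth_nth 0).
  by case: i => [[|[|[|]]]] //= _; case: p.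
have /dhomogP hq := dhomog_is_dhomog q.
rewrite /comp_curve /mmap big_seq; apply: (leq_trans (size_sum _ _ _)).
apply/bigmax_leqP_seq => e eq_in _; rewrite mul_polyC.
apply: (leq_trans (size_scale_leq _ _)).
have <- : mdeg e = m by exact: hq.
rewrite /mmap1 mdegE big_distrl /=.
elim/big_rec2: _ => [|i s f _ IH]; first by rewrite size_poly1.
apply: (leq_trans (size_polyMleq _ _)).
have h : (size (curve_coord p i ^+ e i) <= (e i * n).+1)%N.
  apply: (leq_trans (size_poly_exp_leq _ _)).
  by rewrite ltnS mulnC leq_mul2l -subn1 leq_subLR add1n sp orbT.
by rewrite -subn1 leq_subLR add1n (leq_trans (leq_add h IH)) // addSn addnS.
Qed.

Lemma bernstein_matrix_exists (R : realType) (n m M L : nat)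
    (p : rational_curve R n) (q : M.-tuple (dhomog 3 R m)) :
  (maxn 2 (m * n + 1) <= L)%N ->
  exists D : 'M[R]_(L, M), is_bernstein_matrix p q D.
Proof.
rewrite geq_max addn1 => /andP[_]; case: L => // d hd.
have [c Hc] := choice (fun k : 'I_M =>
  bernstein_span (leq_trans (size_comp_curve (tnth q k) p) hd)).
by exists (\matrix_(j, k) c k j) => k; rewrite Hc; apply: eq_bigr => j _; rewrite mxE.
Qed.

(* Main.v *)
(* A polynomial [\sum_i a_i X^i] has degree [d] Bernstein coefficients
   [\sum_i a_i (j ^_ i / d ^_ i)], while its value at the node [j / d] is
   [\sum_i a_i (j / d) ^ i].  The ratio [j ^_ i / d ^_ i] is a product of [i]
   factors [(j - s) / (d - s)] of [0, 1], each within [i / d] of [j / d], so the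
   two differ by at most [i ^ 2 / d], uniformly in [j]. *)
Require Import Defs.
From HB Require Import structures.
From mathcomp Require Import all_boot all_order all_algebra.
From mathcomp Require Import all_classical all_reals all_analysis.
From mathcomp Require Import -(notations) mpoly.
From mathcomp Require Import ring.
Import Order.TTheory GRing.Theory Num.Theory numFieldNormedType.Exports.
Local Open Scope classical_set_scope.
Local Open Scope ring_scope.

(** Triangularity: [bernstein R d i] is divisible by ['X^i], so once all [c i] with [i < j] are
    zero, the coefficient of ['X^j] in the sum is [c j * 'C(d, j)]. *)
Lemma bernstein_free (R : realType) (d : nat) (c : 'I_d.+1 -> R) :
  \sum_(j < d.+1) c j *: bernstein R d j = 0 -> forall j, c j = 0.
Proof.
move=> c0 j; have [e] := ubnP (j : nat); elim: e j => // e IH j je.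
have /(congr1 (fun a : {poly R} => a`_j)) := c0.
rewrite coef_sum coef0 (bigD1 j) //= big1 ?addr0 => [|i ij].
  rewrite /bernstein !coefZ coefXnM ltnn subnn.
  have -> : ((1 - 'X : {poly R}) ^+ (d - j))`_0 = 1.
    by rewrite -horner_coef0 horner_exp !hornerE subr0 expr1n.
  rewrite mulr1 => cj0; apply: (mulIf _ (etrans cj0 (esym (mul0r _)))).
  by rewrite pnatr_eq0 -lt0n bin_gt0 -ltnS ltn_ord.
rewrite /bernstein !coefZ coefXnM; case: ltnP => [_|le_ij]; first by rewrite !mulr0.
by rewrite IH ?mul0r // (@leq_trans j) // ltn_neqAle ij.
Qed.

(** Multiplied by [(j - i)! (d - j)!], both sides become [d!]. *)
Lemma ffact_mul_bin (d i j : nat) : (i <= j <= d)%N ->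
  (d ^_ i * 'C(d - i, j - i) = 'C(d, j) * j ^_ i)%N.
Proof.
move=> /andP[ij jd]; apply/eqP.
have pos : (0 < (j - i)`! * (d - j)`!)%N by rewrite muln_gt0 !fact_gt0.
rewrite -(eqn_pmul2r pos) -!mulnA [(j ^_ i * _)%N]mulnA ffact_fact // bin_fact //.
rewrite -(_ : d - i - (j - i) = d - j)%N; last by rewrite -subnDA subnKC.
by rewrite bin_fact ?leq_sub2r // ffact_fact // (leq_trans ij).
Qed.

(** Binomial expansion of ['X^i * ((1 - 'X) + 'X) ^+ (d - i)], reindexed by [j = k + i]; the terms
    with [j < i] vanish because [j ^_ i = 0]. *)
Lemma bernstein_Xn (R : realType) (d i : nat) : (i <= d)%N ->
  'X^i = \sum_(j < d.+1) ((j ^_ i)%:R / (d ^_ i)%:R) *: bernstein R d j.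
Proof.
move=> id.
have -> : 'X^i = 'X^i * ((1 - 'X) + 'X) ^+ (d - i) :> {poly R}.
  by rewrite subrK expr1n mulr1.
pose F j : {poly R} := ((j ^_ i)%:R / (d ^_ i)%:R) *: bernstein R d j.
rewrite -[RHS](big_mkord xpredT F) (big_cat_nat (n := i)) //=; last exact: ltnW.
rewrite big_nat big1 ?add0r; last first.
  by move=> j /andP[_ ji]; rewrite /F ffact_small // mul0r scale0r.
have := big_addn 0 d.+1 i xpredT F; rewrite add0n => ->.
rewrite exprDn mulr_sumr big_mkord subSn //.
apply: eq_bigr => k _; rewrite /F /bernstein scalerA.
have kd : (k + i <= d)%N by rewrite addnC -leq_subRL// -ltnS.
have di0 : (d ^_ i)%:R != 0 :> R by rewrite pnatr_eq0 -lt0n ffact_gt0.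
have -> : ((k + i) ^_ i)%:R / (d ^_ i)%:R * 'C(d, k + i)%:R
    = 'C(d - i, k)%:R :> R.
  have := @ffact_mul_bin d i (k + i); rewrite leq_addl addnK => /(_ kd) e.
  by apply: (mulfI di0); rewrite -natrM e natrM; field.
rewrite scaler_nat mulrnAr -subnDA [(i + k)%N]addnC exprD; congr (_ *+ _).
by rewrite [X in _ * X]mulrC mulrA [X in X * _]mulrC.
Qed.

(** Induction on [i]: each new factor of the falling factorials adds an error of at most [i / d]. *)
Lemma ffact_ratio_dist (R : realType) (d i j : nat) :
  (0 < d)%N -> (i <= d)%N -> (j <= d)%N ->
  `|(j ^_ i)%:R / (d ^_ i)%:R - (j%:R / d%:R) ^+ i| <= (i ^ 2)%:R / d%:R :> R.
Proof.
move=> d0 + jd; elim: i => [_|i IH id].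
  by rewrite !ffactn0 expr0 divr1 subrr normr0 mul0r.
have d0' : 0 < d%:R :> R by rewrite ltr0n.
have jd' : j%:R <= d%:R :> R by rewrite ler_nat.
have x0 : 0 <= j%:R / d%:R :> R by rewrite divr_ge0.
have x1 : j%:R / d%:R <= 1 :> R by rewrite ler_pdivrMr // mul1r.
have di0 : 0 < (d ^_ i)%:R :> R by rewrite ltr0n ffact_gt0 ltnW.
have dsi : 0 < (d - i)%:R :> R by rewrite ltr0n subn_gt0.
have P1 : (j ^_ i)%:R / (d ^_ i)%:R <= 1 :> R.
  rewrite ler_pdivrMr // mul1r ler_nat !ffact_prod.
  by apply: leq_prod => s _; exact: leq_sub2r.
have P0 : 0 <= (j ^_ i)%:R / (d ^_ i)%:R :> R by rewrite divr_ge0.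
have factor : `|(j - i)%:R / (d - i)%:R - j%:R / d%:R| <= i%:R / d%:R :> R.
  (* If [j < i], the truncated [j - i] is 0 and the distance is just [j / d]. *)
  have [ij|ji] := leqP i j; last first.
    have /eqP -> : (j - i == 0)%N by rewrite subn_eq0 ltnW.
    rewrite mul0r sub0r normrN ger0_norm //.
    by rewrite ler_pM2r ?invr_gt0 // ler_nat ltnW.
  (* The cofactor [(d - j) / (d - i)] is at most 1 since [i <= j]. *)
  have -> : (j - i)%:R / (d - i)%:R - j%:R / d%:R
      = - (i%:R / d%:R * ((d - j)%:R / (d - i)%:R)) :> R.
    move: dsi; rewrite !natrB // 1?ltnW // => dsi; field.
    by rewrite !gt_eqF.
  rewrite normrN ger0_norm ?mulr_ge0 ?divr_ge0 ?invr_ge0 //.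
  rewrite ler_piMr ?divr_ge0 // ler_pdivrMr // mul1r ler_nat.
  exact: leq_sub2l.
rewrite !ffactnSr [(j ^_ i * _)%:R]natrM [(d ^_ i * _)%:R]natrM invfM exprS.
set P := (_ / (d ^_ i)%:R) in P0 P1 IH *.
set x := (j%:R / d%:R) in x0 x1 IH factor *.
set f := ((j - i)%:R / (d - i)%:R) in factor.
(* Telescoping: [P] and [x] lie in [0, 1], so the errors of [f] and of [P] simply add. *)
have -> : (j ^_ i)%:R * (j - i)%:R * ((d ^_ i)%:R^-1 * (d - i)%:R^-1) - x * x ^+ i
   = P * (f - x) + x * (P - x ^+ i) :> R by rewrite /P /f; ring.
clearbody P x f; apply: (le_trans (ler_normD _ _)); rewrite !normrM (ger0_norm P0) (ger0_norm x0).
(* The first two terms bound the two errors; the third is slack. *)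
have -> : (i.+1 ^ 2)%:R / d%:R = i%:R / d%:R + (i ^ 2)%:R / d%:R + i.+1%:R / d%:R :> R.
  by rewrite -!mulrDl -!natrD; congr (_%:R / _); ring.
rewrite -[X in X <= _]addr0 lerD ?divr_ge0 // lerD //.
  by rewrite (le_trans _ factor) // ler_piMl.
by rewrite (le_trans _ (IH (ltnW id))) // ler_piMl.
Qed.

(** The numerator of the bound depends on neither [d] nor [j], which gives uniformity in [j] as the
    degree is raised. *)
Lemma bernstein_coef_dist (R : realType) (d N : nat) (a : {poly R})
    (c : 'I_d.+1 -> R) :
  (0 < d)%N -> (N <= d)%N -> (size a <= N.+1)%N ->
  a = \sum_(j < d.+1) c j *: bernstein R d j ->
  forall j : 'I_d.+1, `|c j - a.[j%:R / d%:R]|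
    <= (\sum_(i < N.+1) `|a`_i| * (i ^ 2)%:R) / d%:R.
Proof.
move=> d0 Nd sa ac j.
(* Both families represent [a], so freeness makes them equal. *)
have cE : c j = \sum_(i < N.+1) a`_i * ((j ^_ i)%:R / (d ^_ i)%:R).
  pose b (l : 'I_d.+1) := \sum_(i < N.+1) a`_i * ((l ^_ i)%:R / (d ^_ i)%:R).
  apply/eqP; rewrite -subr_eq0; apply/eqP.
  apply: (@bernstein_free _ _ (fun l => c l - b l)).
  under eq_bigr => l _ do rewrite scalerBl.
  rewrite sumrB -ac; apply/eqP; rewrite subr_eq0; apply/eqP.
  under eq_bigr => l _ do rewrite scaler_suml.
  rewrite exchange_big /=.
  have -> : a = \sum_(i < N.+1) a`_i *: 'X^i.
    rewrite -poly_def; apply/polyP => i; rewrite coef_poly.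
    by case: ltnP => // hi; rewrite nth_default // (leq_trans sa).
  apply: eq_bigr => i _; rewrite -poly_def coef_poly ltn_ord.
  rewrite (@bernstein_Xn R d i) ?scaler_sumr; last first.
    by rewrite (leq_trans _ Nd) // -ltnS.
  by apply: eq_bigr => l _; rewrite scalerA.
rewrite cE (horner_coef_wide _ sa) -sumrB mulr_suml.
apply: (le_trans (ler_norm_sum _ _ _)); apply: ler_sum => i _.
rewrite -mulrBr normrM -mulrA ler_wpM2l // ffact_ratio_dist //.
  by rewrite (leq_trans _ Nd) // -ltnS.
by rewrite -ltnS.
Qed.

Theorem proposition4 (R : realType) (n m : nat) (p : rational_curve R n)
    (q : 'C(m + 2, 2).-tuple (dhomog 3 R m))
    (basis_q : basis_of {:dhomog 3 R m} q)
    (DB : forall L : nat, 'M[R]_(L, 'C(m + 2, 2)))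
    (bernstein_DB : forall L : nat, (maxn 2 (m * n + 1) <= L)%N ->
      is_bernstein_matrix p q (DB L))
    (k : 'I_'C(m + 2, 2)) :
  (fun L : nat =>
     \big[Num.max/0]_(j < L) `|DB L j k - lagrange_matrix p q L j k|)
    @ \oo --> (0 : R).
Proof.
pose a := comp_curve (tnth q k) p.
pose K : R := \sum_(i < (m * n).+1) `|a`_i| * (i ^ 2)%:R.
have K0 : 0 <= K by apply: sumr_ge0 => i _; rewrite mulr_ge0.
apply: (@squeeze_cvgr _ _ _ _ (fun=> 0) (fun L => K / L.-1%:R)).
- near=> L; apply/andP; split.
    by apply: bigmax_ge_id.
  have hL : (maxn 2 (m * n + 1) <= L)%N by near: L; exact: nbhs_infty_ge.
  (* With [L = d + 1], the Bernstein degree is [d], and the bound on [L] gives [0 < d] and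
     [m * n <= d]. *)
  move: (bernstein_DB L hL k) => hk; move: hL (DB L) hk; case: (L) => [|d].
    by rewrite geq_max.
  rewrite geq_max addn1 !ltnS => /andP[d0 Nd] D hk.
  apply: bigmax_le => [|j _]; first by rewrite divr_ge0.
  rewrite mxE.
  exact: (@bernstein_coef_dist _ _ _ _ _ d0 Nd (size_comp_curve _ _) hk j).
- exact: cvg_cst.
(* Shifting by 2 turns [K / (L - 1)] into [K / (L + 1)], a multiple of the harmonic sequence. *)
- rewrite -(cvg_shiftn 2).
  have -> : (fun L => K / (L + 2).-1%:R) = cst K \* harmonic.
    by apply/funext => L; rewrite addn2.
  by have := cvgM (cvg_cst K) (@cvg_harmonic R); rewrite mulr0; apply.
Unshelve. all: by end_near.
Qed.
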